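(* Let $n\geq 3$. The diameter of the network realignment graph $\mathcal G_n$ satisfies \[ \left\lfloor \frac{3n^2-4n}{8}\right\rfloor\leq \operatorname{diam}(\mathcal G_n)\leq \frac{n^2}{2}-n \] if $n$ is even, and \[ \left\lfloor \frac{3n^2-6n}{8}\right\rfloor\leq \operatorname{diam}(\mathcal G_n)\leq \frac{n^2-1}{2}-n \] if $n$ is odd.
   Context: The network realignment graph $\mathcal G_n$ has as vertices all labelled trees on the vertex set $[n]=\{1,\dots,n\}$ (spanning trees of $K_n$). Two trees are adjacent if they differ by a single leaf slide: $T_2$ is obtained from $T_1$ by choosing a leaf $v$ of $T_1$ with neighbour $u$ and a neighbour $w\ne v$ of $u$ in $T_1$, deleting the edge $(v,u)$ and inserting the edge $(v,w)$. $d_{\mathcal G_n}$ is the graph distance, and $\operatorname{diam}(\mathcal G_n)=\max_{T_1,T_2}d_{\mathcal G_n}(T_1,T_2)$. *)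

(* Defs.v *)
From mathcomp Require Import all_boot.

Set Implicit Arguments.
Unset Strict Implicit.
Unset Printing Implicit Defensive.

Section GraphDistance.
Variables (V : finType) (e : rel V).

Definition walk (k : nat) (x y : V) : Prop :=
  exists p : seq V, [/\ path e x p, last x p = y & size p = k].

(* Relational, so that no value has to be invented for the distance between
   two vertices in different components. *)
Definition is_dist (x y : V) (d : nat) : Prop :=
  walk d x y /\ forall k, walk k x y -> d <= k.

Definition is_diameter (D : nat) : Prop :=
  (forall x y, exists2 d, is_dist x y d & d <= D) /\
  (exists x y, is_dist x y D).

Lemma is_dist_uniq x y d d' : is_dist x y d -> is_dist x y d' -> d = d'.
Proof.
move=> [w m] [w' m']; apply/eqP.
by rewrite eqn_leq (m _ w') (m' _ w).
Qed.

Lemma is_diameter_uniq D D' : is_diameter D -> is_diameter D' -> D = D'.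
Proof.
move=> [u [x [y xy]]] [u' [x' [y' xy']]]; apply/eqP; rewrite eqn_leq.
have [d dxy dD] := u' x y; have [d' dxy' dD'] := u x' y'.
by rewrite {1}(is_dist_uniq xy dxy) dD {1}(is_dist_uniq xy' dxy') dD'.
Qed.

End GraphDistance.

Section Trees.
Variable n : nat.
Implicit Type E : {set {set 'I_n}}.

Definition adj E : rel 'I_n := [rel u v | [set u; v] \in E].

Definition simple E : bool := [forall a in E, #|a| == 2].

Definition connected E : bool := [forall u, forall v, connect (adj E) u v].

(* A cycle without repeated vertices has at most n vertices; see acyclicP. *)
Definition acyclic E : bool :=
  [forall k : 'I_n.+1, forall p : k.-tuple 'I_n,
     (2 < k) ==> ~~ ucycleb (adj E) p].

Lemma acyclicP E :
  reflect (forall p : seq 'I_n, 2 < size p -> ~ ucycle (adj E) p) (acyclic E).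
Proof.
apply: (iffP idP) => [/forallP ac p p2 cp | ac].
  have sp : size p < n.+1.
    have /andP[_ up] := cp.
    by rewrite ltnS -[n in _ <= n]card_ord -(card_uniqP up) max_card.
  have /forallP/(_ (in_tuple p)) := ac (Ordinal sp).
  by rewrite /= p2 /=; apply/negP; rewrite negbK.
apply/forallP => k; apply/forallP => p; apply/implyP => k2.
by apply/negP; apply: ac; rewrite size_tuple.
Qed.

Definition is_tree E : bool := [&& simple E, connected E & acyclic E].

Definition tree : predArgType := {E : {set {set 'I_n}} | is_tree E}.

Definition leaf E (v : 'I_n) : bool := #|[set u | adj E v u]| == 1.

(* The new edge set is only required to be that of some tree, which it always
   is; slide_sym shows that the adjacency is undirected. *)
Definition slide : rel tree := [rel T1 T2 |
  [exists v, exists u, exists w,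
    [&& leaf (val T1) v, adj (val T1) v u, adj (val T1) u w, w != v
      & val T2 == [set v; w] |: (val T1 :\ [set v; u])]]].

Lemma tree_adj_neq (T : tree) u v : adj (val T) u v -> u != v.
Proof.
case: T => E /= /and3P[/forall_inP sE _ _] /sE.
by rewrite cards2 eqSS eqb1.
Qed.

Lemma slide_sym : symmetric slide.
Proof.
suff H (T1 T2 : tree) : slide T1 T2 -> slide T2 T1.
  by move=> T1 T2; apply/idP/idP; apply: H.
move=> /existsP[v /existsP[u /existsP[w /and5P[lv vu uw wv /eqP e2]]]].
have nvu := tree_adj_neq vu; have nuw := tree_adj_neq uw.
have only z : adj (val T1) v z -> z = u.
  have /cards1P[a ea] := lv.
  have := vu; have -> : adj (val T1) v u = (u \in [set u | adj (val T1) v u]).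
    by rewrite inE.
  rewrite ea inE => /eqP -> vz; apply/eqP.
  have : z \in [set u | adj (val T1) v u] by rewrite inE.
  by rewrite ea inE.
have set2_inj (a b c : 'I_n) : [set a; b] = [set a; c] -> b = c.
  move=> eq; apply/eqP; have : b \in [set a; c] by rewrite -eq set22.
  rewrite !inE => /orP[/eqP ba|//]; have : c \in [set a; b] by rewrite eq set22.
  by rewrite !inE ba orbb eq_sym.
have adj2 z : adj (val T2) v z = (z == w).
  rewrite /adj /= e2 !inE; apply/idP/idP => [/orP[/eqP/set2_inj->//|]|/eqP->].
    by move=> /andP[+ /only zu]; rewrite zu eqxx.
  by rewrite eqxx.
apply/existsP; exists v; apply/existsP; exists w; apply/existsP; exists u.
apply/and5P; split; rewrite ?adj2 ?eqxx //.
- by apply/eqP; rewrite -(cards1 w); apply: eq_card => z; rewrite !inE; apply: adj2.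
- rewrite /adj /= e2 !inE setUC.
  have -> : [set u; w] != [set v; u].
    by apply/eqP; rewrite [in RHS]setUC => /set2_inj wv'; rewrite wv' eqxx in wv.
  by move: uw; rewrite /adj /= => ->; rewrite orbT.
- by rewrite eq_sym.
- rewrite e2 setU1K ?setD1K //; rewrite !inE negb_and; apply/orP; right.
  by apply: contra nuw => /only ->.
Qed.

End Trees.

(* Main.v *)
Require Import Defs.
From mathcomp Require Import all_boot zify.

Set Implicit Arguments.
Unset Strict Implicit.
Unset Printing Implicit Defensive.

(** The upper bound routes every pair of trees through two stars.  Repeatedly
    sliding a deepest leaf one step towards [c] turns a tree into the star
    centred at [c], each slide lowering the sum of the distances to [c] by one
    ([walk_to_star]); a star has sum [n - 1], so this costs the sum minus
    [n - 1].  A vertex minimising the sum has sum at most [n ^ 2 / 4]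
    ([median]), and one star reaches another in [n - 2] slides
    ([walk_star_star]).  The three parts add up to
    [2 * (n ^ 2 / 4) - n].

    The lower bound counts how often each vertex is slid.  Suppose that [c]
    stays put while one of its neighbours [b] is slid at some moment.  At that
    moment [b] is a leaf, so every other vertex that was behind [b] has left
    through the edge [bc] and has been adjacent to [c]: a vertex [y] that was
    behind [b] at distance [d] from [c], and ends at distance [d'], is slid at
    least [(d - 1) + (d' - 1)] times ([run_branch]).  For [n >= 4] the walk
    considered goes between two Hamiltonian paths without a common edge; for
    [n = 3] it suffices that the two paths differ.

    If some [c] is never slid, then all its neighbours in the first path are,
    because their distance to [c] has to change, and the walk has
    length at least the sum of all [d + d' - 2] ([run_lower_unmoved]).  If every
    vertex is slid, let [c] be the last one to be slid for the first time.  Just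
    before that, [c] is a leaf and all other vertices have been slid, so each of
    them but one is at distance at least two from [c]; hence [y] is slid at
    least [d(y, c)] times, with a loss of one at a single vertex
    ([run_all_moved]).  The same holds for the reversed walk, with another
    centre.  The second path places the vertices from the outer part of the
    first one in its own middle, so that the distances of the outer vertices of
    the first path and those of the outer vertices of the second one can be
    added up over disjoint sets of vertices, each contributing about
    [3 * n ^ 2 / 16] whatever the two centres are ([run_lower_moved]). *)

(** * Distances in a finite graph *)

Section Distance.
Variables (V : finType) (e : rel V).

Definition has_walk (x y : V) (k : nat) : bool :=
  [exists p : k.-tuple V, path e x p && (last x p == y)].

Lemma has_walkP x y k : reflect (walk e k x y) (has_walk x y k).
Proof.
apply: (iffP existsP) => [[p /andP[pth /eqP lst]]|[p [pth lst <-]]].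
  by exists p; rewrite size_tuple.
by exists (in_tuple p); rewrite pth lst eqxx.
Qed.

(** A shortest walk has fewer than [#|V|] edges, which makes the search finite;
    the value for vertices in different components is [#|V|]. *)
Definition dist (x y : V) : nat := find (has_walk x y) (iota 0 #|V|).

Lemma dist_min k x y : walk e k x y -> dist x y <= k.
Proof.
move=> /has_walkP wk; rewrite leqNgt; apply/negP => lt_k.
have k_lt : k < #|V|.
  by apply: leq_trans lt_k _; rewrite -[X in _ <= X](size_iota 0) find_size.
by have := before_find 0 lt_k; rewrite nth_iota // add0n wk.
Qed.

Lemma walk_dist x y : connect e x y -> walk e (dist x y) x y.
Proof.
case/connectP=> p pth ->; case/shortenP: pth => q pth uq _.
have hasP : has (has_walk x (last x q)) (iota 0 #|V|).
  apply/hasP; exists (size q); last by apply/has_walkP; exists q.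
  rewrite mem_iota add0n /=.
  by have /card_uniqP/= <- := uq; rewrite max_card.
have := nth_find 0 hasP; rewrite nth_iota; last by move: hasP; rewrite has_find size_iota.
by rewrite add0n => /has_walkP.
Qed.

Lemma dist_is_dist x y : connect e x y -> is_dist e x y (dist x y).
Proof. by move=> cxy; split; [apply: walk_dist | move=> k; apply: dist_min]. Qed.

Lemma distxx x : dist x x = 0.
Proof. by apply/eqP; rewrite -leqn0; apply: dist_min; exists [::]. Qed.

Lemma walk_rev k x y : symmetric e -> walk e k x y -> walk e k y x.
Proof.
move=> e_sym [p [pth <- <-]]; exists (rev (belast x p)); split.
- by rewrite rev_path (eq_path (e' := e)) // => a b; rewrite /= e_sym.
- by case: p {pth} => //= a p; rewrite rev_cons last_rcons.
- by rewrite size_rev size_belast.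
Qed.

Lemma walk_trans k l x y z : walk e k x y -> walk e l y z -> walk e (k + l) x z.
Proof.
case=> p [px py <-] [q [qy qz <-]]; exists (p ++ q).
by rewrite cat_path last_cat px py qy qz size_cat.
Qed.

Hypothesis e_conn : forall x y, connect e x y.

Lemma dist_eq0 x y : dist x y = 0 -> x = y.
Proof.
move=> d0; have [p [_ lst]] := walk_dist (e_conn x y).
by rewrite d0 => /size0nil p0; rewrite -lst p0.
Qed.

Lemma dist_step x y z : e x y -> dist x z <= (dist y z).+1.
Proof.
move=> exy; have [p [py lz sz]] := walk_dist (e_conn y z).
by apply: dist_min; exists (y :: p); rewrite /= exy py lz sz.
Qed.

Lemma dist_pred x z : x != z -> exists2 y, e x y & dist x z = (dist y z).+1.
Proof.
move=> nxz; have [p [py lz sz]] := walk_dist (e_conn x z).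
case: p py lz sz => [|y p] /= py lz sz; first by rewrite lz eqxx in nxz.
have /andP[exy pp] := py; exists y => //; apply/eqP.
rewrite eqn_leq dist_step //= -sz ltnS; apply: dist_min.
by exists p.
Qed.

(** The distance to [z] is determined by being zero at [z], [1]-Lipschitz along
    edges, and lowered by some edge at every other vertex.  Distances after a
    slide and distances in a path are computed by checking these conditions. *)
Lemma dist_unique (f : V -> nat) z :
    f z = 0 -> (forall x y, e x y -> f x <= (f y).+1) ->
    (forall x, x != z -> exists2 y, e x y & f x = (f y).+1) ->
  forall x, dist x z = f x.
Proof.
move=> f0 f_step f_pred x; apply/eqP; rewrite eqn_leq; apply/andP; split.
  move: {2}(f x) (erefl (f x)) => k; elim: k x => [|k IH] x fx.
    by case: (eqVneq x z) => [->|/f_pred[y _]]; rewrite ?distxx // fx.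
  case: (eqVneq x z) => [->|/f_pred[y exy]]; rewrite ?distxx // => fxy.
  by apply: leq_trans (dist_step _ exy) _; rewrite fxy ltnS IH //; lia.
move: {2}(dist x z) (erefl (dist x z)) => k; elim: k x => [|k IH] x dx.
  by rewrite (dist_eq0 dx) f0.
case: (eqVneq x z) => [->|/dist_pred[y exy dxy]]; first by rewrite f0.
by apply: leq_trans (f_step _ _ exy) _; rewrite dxy ltnS IH //; lia.
Qed.

End Distance.

Lemma dist_sym (V : finType) (e : rel V) x y :
  symmetric e -> connect e x y -> dist e x y = dist e y x.
Proof.
move=> e_sym cxy; apply/eqP; rewrite eqn_leq !dist_min //.
  by apply: walk_rev (walk_dist _).
by apply: walk_rev (walk_dist _); rewrite // sym_connect_sym.
Qed.

(** * Distances in a tree *)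

Section TreeDistance.
Variable n : nat.
Implicit Types (T S : tree n) (u v w x y z b c : 'I_n).

Lemma adj_sym (E : {set {set 'I_n}}) : symmetric (adj E).
Proof. by move=> x y; rewrite /adj /= setUC. Qed.

Lemma cycle_two_neighbours (E : {set {set 'I_n}}) p x :
    2 < size p -> ucycle (adj E) p -> x \in p ->
  exists y z, [/\ y != z, y \in p, z \in p, adj E x y & adj E x z].
Proof.
move=> p_gt2 /andP[cyc un] xp; have [i q def_q] := rot_to xp.
move: cyc un p_gt2; rewrite -(rot_cycle i) -(rot_uniq i) -(size_rot i) def_q.
have q_p y : y \in q -> y \in p by move=> yq; rewrite -(mem_rot i) def_q inE yq orbT.
case: q {def_q} q_p => [//|y q]; case/lastP: q => [//|q z] q_p cyc un _.
exists y, z; split.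
- by apply: contraTneq un => ->; rewrite /= mem_rcons mem_head /= andbF.
- by apply: q_p; rewrite mem_head.
- by apply: q_p; rewrite inE mem_rcons mem_head orbT.
- by move: cyc; rewrite (cycle_path x) /= last_rcons => /and3P[].
by move: cyc; rewrite (cycle_path x) /= last_rcons adj_sym => /and3P[].
Qed.

Lemma tree_connect T x y : connect (adj (val T)) x y.
Proof. by case: T => E /= /and3P[_ /forallP/(_ x)/forallP/(_ y) ? _]. Qed.

Lemma set2_eq (a b c d : 'I_n) :
  ([set a; b] == [set c; d]) = ((a == c) && (b == d)) || ((a == d) && (b == c)).
Proof.
apply/eqP/idP => [eqab|]; last first.
  by case/orP=> /andP[/eqP-> /eqP->] //; rewrite setUC.
have := set21 a b; have := set22 a b; rewrite {1 2}eqab.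
have := set21 c d; have := set22 c d; rewrite -{1 2}eqab !inE.
rewrite ![d == _]eq_sym ![c == _]eq_sym.
by case: (a == c); case: (a == d); case: (b == c); case: (b == d).
Qed.

Lemma tree_ext T S : (forall x y, adj (val T) x y = adj (val S) x y) -> T = S.
Proof.
move=> eqTS; apply: val_inj; apply/setP => a.
case: (boolP (#|a| == 2)) => [/cards2P[x [y] [_ ->]]|ca]; first exact: eqTS.
have notin (R : tree n) : a \notin val R.
  apply: contra ca => aR.
  by case: R aR => E /= /and3P[/forall_inP sE _ _] /sE.
by rewrite (negPf (notin T)) (negPf (notin S)).
Qed.

Definition tdist T : 'I_n -> 'I_n -> nat := dist (adj (val T)).

Lemma tdistC T x y : tdist T x y = tdist T y x.
Proof. by apply: dist_sym; [apply: adj_sym | apply: tree_connect]. Qed.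

Lemma tdistxx T x : tdist T x x = 0. Proof. exact: distxx. Qed.

Lemma tdist_eq0 T x y : (tdist T x y == 0) = (x == y).
Proof.
apply/eqP/eqP => [|->]; last exact: tdistxx.
by apply: dist_eq0; apply: tree_connect.
Qed.

Lemma tdist_step T x y z : adj (val T) x y -> tdist T x z <= (tdist T y z).+1.
Proof. by apply: dist_step; apply: tree_connect. Qed.

Lemma tdist_stepr T x y z : adj (val T) x y -> tdist T z x <= (tdist T z y).+1.
Proof. by rewrite ![tdist T z _]tdistC; apply: tdist_step. Qed.

Lemma tdist_pred T x z : x != z ->
  exists2 y, adj (val T) x y & tdist T x z = (tdist T y z).+1.
Proof. by apply: dist_pred; apply: tree_connect. Qed.

Lemma tdist_adj T x y : adj (val T) x y -> tdist T x y = 1.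
Proof.
move=> xy; apply/eqP; rewrite eqn_leq lt0n tdist_eq0 (tree_adj_neq xy) andbT.
by apply: leq_trans (tdist_step _ xy) _; rewrite tdistxx.
Qed.

Lemma tdist_eq1 T x y : tdist T x y = 1 -> adj (val T) x y.
Proof.
move=> d1; have /(tdist_pred T)[z xz] : x != y by rewrite -(tdist_eq0 T) d1.
by rewrite d1 => -[/esym/eqP]; rewrite tdist_eq0 => /eqP <-.
Qed.

(** A walk from [p] to [q] avoiding their common neighbour [u] would close up to
    a cycle through [u]. *)
Lemma no_detour T u p q :
    adj (val T) u p -> adj (val T) u q ->
    connect [rel x y | [&& adj (val T) x y, x != u & y != u]] p q ->
  p = q.
Proof.
move=> up uq /connectP[s pth eq_q].
have /and3P[_ _ /acyclicP acT] := valP T.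
case/shortenP: pth eq_q => s' pth un _ eq_q.
case: s' pth un eq_q => [//|a s'] pth un eq_q; case: (acT [:: u, p, a & s'] isT).
have pu : p != u by rewrite eq_sym (tree_adj_neq up).
rewrite /ucycle /ucycleb; apply/andP; split.
  rewrite (cycle_path u) /=; move: eq_q => /= <-; rewrite adj_sym uq up /=.
  by apply: sub_path pth => x y /= /andP[].
rewrite cons_uniq un andbT inE negb_or eq_sym pu /=.
move: (a :: s') p pth {up un eq_q pu} => r; elim: r => //= y r IH x /andP[/and3P[_ _ yu]].
by move=> /IH; rewrite inE negb_or [u == y]eq_sym yu.
Qed.

(** Two neighbours of [u] that are not farther from [c] than [u] are both joined
    to [c] by shortest walks, and these avoid [u]. *)
Lemma parent_uniq T c u p q : u != c ->
    adj (val T) u p -> adj (val T) u q ->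
    tdist T p c <= tdist T u c -> tdist T q c <= tdist T u c ->
  p = q.
Proof.
move=> uc up uq dp dq; apply: (no_detour up uq).
set R := [rel x y | _].
have Rsym : symmetric R.
  by move=> x y; rewrite /R /= adj_sym [(x != u) && _]andbC.
have toc x : x != u -> tdist T x c <= tdist T u c -> connect R x c.
  move: {2}(tdist T x c) (erefl (tdist T x c)) => k; elim: k x => [|k IH] x dx xu du.
    by move/eqP: dx; rewrite tdist_eq0 => /eqP->.
  have /(tdist_pred T)[y xy dxy] : x != c by rewrite -(tdist_eq0 T) dx.
  have yu : y != u by apply: contraTneq du => <-; rewrite dxy ltnn.
  apply: connect_trans (IH y _ yu _); [apply: connect1|lia|lia].
  by rewrite /R /= xy xu yu.
apply: connect_trans (toc p _ dp) _; first by rewrite eq_sym (tree_adj_neq up).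
by rewrite (sym_connect_sym Rsym) toc // eq_sym (tree_adj_neq uq).
Qed.

(** Trees are bipartite: the other end of an edge with both ends equally far
    from [c] would be a second neighbour competing with the parent. *)
Lemma tdist_adj_neq T c x y : adj (val T) x y -> tdist T x c != tdist T y c.
Proof.
move=> xy; apply/eqP => dxy; have nxy := tree_adj_neq xy.
have xc : x != c.
  apply: contraNneq nxy => xc; move/eqP: dxy; rewrite xc tdistxx eq_sym tdist_eq0.
  by rewrite eq_sym.
have [p xp dp] := tdist_pred T xc.
have yp := parent_uniq xc xy xp; have := yp; rewrite dxy leqnn -dxy => /(_ isT) {}yp.
by have := yp; rewrite dp => /(_ (leqnSn _)) ey; move: dp; rewrite -ey; lia.
Qed.

End TreeDistance.

(** * Leaf slides and branches *)

Section Slides.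
Variable n : nat.
Implicit Types (T S : tree n) (u v w x y z b c : 'I_n) (vs : seq 'I_n).

(** The slide of the leaf [v] from [u] to [w], written through adjacencies so
    that exchanging the two trees exchanges [u] and [w]. *)
Definition slide_from T T' v u w : Prop :=
  [/\ forall x, adj (val T) v x = (x == u),
      forall x, adj (val T') v x = (x == w),
      adj (val T) u w
    & forall x y, x != v -> y != v -> adj (val T') x y = adj (val T) x y].

Definition slides v T T' : Prop := exists u w, slide_from T T' v u w.

Lemma slide_from_neq T T' v u w :
  slide_from T T' v u w -> [/\ u != v, w != v & adj (val T') u w].
Proof.
move=> [Tv T'v uw keep].
have uv : u != v by rewrite eq_sym (tree_adj_neq (T := T)) // Tv.
have wv : w != v by rewrite eq_sym (tree_adj_neq (T := T')) // T'v.
by rewrite keep.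
Qed.

Lemma slide_from_sym T T' v u w : slide_from T T' v u w -> slide_from T' T v w u.
Proof.
move=> sl; have [_ _ uw'] := slide_from_neq sl; case: sl => [Tv T'v uw keep].
by split=> //; [rewrite adj_sym | move=> x y xv yv; rewrite keep].
Qed.

Lemma slides_sym v T T' : slides v T T' -> slides v T' T.
Proof. by move=> [u [w /slide_from_sym ?]]; exists w, u. Qed.

Lemma leafP T v u : leaf (val T) v -> adj (val T) v u ->
  forall x, adj (val T) v x = (x == u).
Proof.
move=> /cards1P[a ea] vu x.
have inN y : adj (val T) v y = (y == a) by rewrite -in_set1 -ea inE.
by have := inN u; rewrite vu inN => /esym/eqP->.
Qed.

Lemma slide_slides T T' : slide T T' -> exists v, slides v T T'.
Proof.
move=> /existsP[v /existsP[u /existsP[w /and5P[lv vu uw wv /eqP eT']]]].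
exists v, u, w; have Tv := leafP lv vu; have uv := tree_adj_neq vu.
split=> // [x|x y xv yv]; rewrite /adj /= eT' !inE !set2_eq ?eqxx /=.
  have -> : ([set v; x] \in val T) = (x == u) by apply: Tv.
  have [->|xw] := eqVneq x w; rewrite //= ?[v == w]eq_sym (negPf wv) /=.
  by rewrite (negPf uv) orbF andNb.
by rewrite (negPf xv) (negPf yv) !andbF.
Qed.

Lemma tdist_leaf T v u z : (forall x, adj (val T) v x = (x == u)) -> z != v ->
  tdist T v z = (tdist T u z).+1.
Proof.
move=> Tv zv; have [y] : exists2 y, adj (val T) v y & tdist T v z = (tdist T y z).+1.
  by apply: tdist_pred; rewrite eq_sym.
by rewrite Tv => /eqP->.
Qed.

(** Shortest walks between two other vertices do not pass through the leaf. *)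
Lemma tdist_keep T T' v u w x z : slide_from T T' v u w -> x != v -> z != v ->
  tdist T' x z = tdist T x z.
Proof.
move=> sl xv zv; have [uv wv uw'] := slide_from_neq sl.
have [Tv T'v uw keep] := sl.
pose f y := if y == v then (tdist T w z).+1 else tdist T y z.
rewrite [LHS](@dist_unique _ _ (@tree_connect _ T') f z) /f ?(negPf xv) //.
- by rewrite (negPf zv) tdistxx.
- move=> a b ab; case: eqP ab => [->|/eqP av].
    by rewrite T'v => /eqP->; rewrite (negPf wv).
  case: eqP => [->|/eqP bv]; last by rewrite keep //; apply: tdist_step.
  by rewrite adj_sym T'v => /eqP->; clear; lia.
move=> a az; case: eqP => [->|/eqP av].
  by exists w; rewrite ?T'v // (negPf wv).
have [b ab dab] := tdist_pred T az.
have bv : b != v.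
  apply: contraPneq dab => bv; rewrite bv (tdist_leaf Tv) //.
  by move: ab; rewrite bv adj_sym Tv => /eqP->; clear; lia.
by exists b; rewrite ?keep // (negPf bv).
Qed.

Lemma tdist_slid T T' v u w z : slide_from T T' v u w -> z != v ->
  tdist T' v z = (tdist T w z).+1.
Proof.
move=> sl zv; have [uv wv uw'] := slide_from_neq sl; have [_ T'v _ _] := sl.
by rewrite (tdist_leaf T'v zv) (tdist_keep sl).
Qed.

Lemma tdist_slide_le T T' v x z : slides v T T' -> z != v ->
  tdist T' x z <= tdist T x z + (x == v).
Proof.
move=> [u [w sl]] zv; have [xv|xv] := eqVneq x v; last by rewrite (tdist_keep sl) // addn0.
have [Tv _ uw _] := sl.
rewrite xv (tdist_slid sl) // (tdist_leaf Tv) //.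
by rewrite addn1 ltnS; apply: tdist_step; rewrite adj_sym.
Qed.

(** Every cycle of the new edge set avoids [v], whose only neighbour is [w], and
    is therefore a cycle of [T]. *)
Lemma slide_exists T v u w :
    (forall x, adj (val T) v x = (x == u)) -> adj (val T) u w -> w != v ->
  exists2 T', slide T T' & slide_from T T' v u w.
Proof.
move=> Tv uw wv; have vu : adj (val T) v u by rewrite Tv.
have uv : u != v by rewrite eq_sym (tree_adj_neq vu).
have wu : w != u by rewrite eq_sym (tree_adj_neq uw).
pose E' := [set v; w] |: (val T :\ [set v; u]).
have keep x y : x != v -> y != v -> adj E' x y = adj (val T) x y.
  by move=> /negPf xv /negPf yv; rewrite /adj /= !inE !set2_eq xv yv !andbF.
have E'v x : adj E' v x = (x == w).
  have := Tv x; rewrite /adj /= !inE !set2_eq eqxx /= [v == w]eq_sym (negPf wv) orbF => ->.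
  by rewrite [v == u]eq_sym (negPf uv) orbF andNb orbF.
have vw : adj E' v w by rewrite E'v.
have E's : symmetric (adj E') := @adj_sym n E'.
have tree_E' : is_tree E'.
  apply/and3P; split.
  - have /and3P[/forall_inP sE _ _] := valP T.
    apply/forall_inP => a; rewrite !inE => /orP[/eqP->|/andP[_ /sE//]].
    by rewrite cards2 [v == w]eq_sym wv.
  - apply/forallP => x; apply/forallP => y.
    have := tree_connect T x y; apply: connect_sub => {}x {}y xy.
    have toward z : adj (val T) v z -> connect (adj E') v z.
      rewrite Tv => /eqP->; apply: connect_trans (connect1 vw) (connect1 _).
      by rewrite keep // adj_sym.
    have [xv|xv] := eqVneq x v; first by rewrite xv; apply: toward; rewrite -xv.
    have [yv|yv] := eqVneq y v; last by apply: connect1; rewrite keep.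
    by rewrite (sym_connect_sym E's) yv; apply: toward; rewrite -yv adj_sym.
  apply/acyclicP => p p_gt2 cyc; have /and3P[_ _ /acyclicP acT] := valP T.
  have vp : v \notin p.
    apply/negP => vp; have [y [z [yz _ _]]] := cycle_two_neighbours p_gt2 cyc vp.
    by rewrite !E'v => /eqP yw /eqP zw; rewrite yw zw eqxx in yz.
  apply: (acT p p_gt2); move: cyc; rewrite /ucycle /ucycleb => /andP[cyc ->].
  rewrite andbT; apply: (sub_in_cycle (P := predC1 v)) _ cyc.
    by move=> x y; rewrite !inE => xv yv; rewrite keep.
  by apply/allP => x xp; apply: contraNneq vp => <-.
exists (Sub E' tree_E' : tree n); last by split.
apply/existsP; exists v; apply/existsP; exists u; apply/existsP; exists w.
rewrite vu uw wv /= eqxx !andbT; apply/cards1P; exists u.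
by apply/setP => x; rewrite !inE Tv.
Qed.

(** For adjacent [b] and [c], the vertices on the side of [b] once the edge [bc]
    is removed. *)
Definition branch T b c := [set y | tdist T y c == (tdist T y b).+1].

(** The edge [bc] is the only one leaving the branch. *)
Lemma branch_exit T b c u w : adj (val T) b c -> adj (val T) u w ->
  u \in branch T b c -> w \notin branch T b c -> u = b /\ w = c.
Proof.
move=> bc uw; have cb : adj (val T) c b by rewrite adj_sym.
rewrite !inE => /eqP du dw.
have uc : u != c by rewrite -(tdist_eq0 T) du.
have := tdist_adj_neq c uw; rewrite neq_ltn => /orP[lt_uw|lt_wu].
  have wu : adj (val T) w u by rewrite adj_sym.
  by have := tdist_step c wu; have := tdist_step b wu; have := tdist_stepr w cb; lia.
have [ub|ub] := eqVneq u b.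
  split=> //; apply: (parent_uniq uc uw); rewrite ?tdistxx //; last exact: ltnW.
  by rewrite ub.
have [p up dp] := tdist_pred T ub.
have pc : tdist T p c <= tdist T u c.
  by have := tdist_stepr p cb; lia.
have pw := parent_uniq uc up uw pc (ltnW lt_wu); subst p.
by have := tdist_step c uw; have := tdist_stepr w cb; lia.
Qed.

End Slides.

(** * Indicator sums *)

Section IndicatorSums.
Variable V : finType.

Lemma sum_eq1 (z : V) : \sum_y (y == z) = 1.
Proof. by rewrite (bigD1 z) //= eqxx big1 // => y /negPf->. Qed.

Lemma sum_neq (z : V) : \sum_y (y != z) = #|V|.-1.
Proof.
have : \sum_y ((y != z) + (y == z)) = #|V|.
  by rewrite -sum1_card; apply: eq_bigr => y _; case: (y == z).
by rewrite big_split /= sum_eq1; clear; lia.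
Qed.

Lemma sum_mem (A : {set V}) : \sum_x (x \in A) = #|A|.
Proof. by rewrite -sum1_card [RHS]big_mkcond; apply: eq_bigr => x _; case: (x \in A). Qed.

End IndicatorSums.

Lemma sum_lt d h : d <= h -> \sum_(i < h) (i < d) = d.
Proof.
move=> le_dh; rewrite -[RHS](card_ord d) -sum1_card (big_ord_widen h (fun=> 1) le_dh).
by rewrite [RHS]big_mkcond; apply: eq_bigr => i _; case: (i < d).
Qed.

(** * The upper bound *)

Section UpperBound.
Variable n : nat.
Implicit Types (T S : tree n) (u v w x y z b c : 'I_n).

Definition total_dist T c : nat := \sum_y tdist T y c.

(** As long as some vertex has distance at least two from [c], a farthest one is
    a leaf, and sliding it past its neighbour towards [c] lowers the sum of the
    distances by exactly one. *)
Lemma walk_to_star T c : exists j S,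
  [/\ walk (@slide n) j T S, j + n.-1 <= total_dist T c
    & forall y, tdist S y c <= 1].
Proof.
have [k] := ubnP (total_dist T c); elim: k T => // k IH T; rewrite ltnS => le_k.
pose v := [arg max_(v > c) tdist T v c].
have v_max y : tdist T y c <= tdist T v c by rewrite /v; case: arg_maxnP => // i _; apply.
have [v_le1|v_gt1] := leqP (tdist T v c) 1.
  exists 0, T; split; first by exists [::].
    rewrite -[n in n.-1]card_ord -(sum_neq c); apply: leq_sum => y _.
    by have := tdist_eq0 T y c; case: (y == c); case: (tdist T y c).
  by move=> y; apply: leq_trans (v_max y) v_le1.
have vc : v != c by rewrite -(tdist_eq0 T); move: v_gt1; clear; lia.
have [u vu du] := tdist_pred T vc.
have uc : u != c by rewrite -(tdist_eq0 T); move: v_gt1; rewrite du; clear; lia.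
have [w uw dw] := tdist_pred T uc.
have Tv x : adj (val T) v x = (x == u).
  apply/idP/eqP => [vx|->//]; apply: (parent_uniq vc vx vu (v_max x)).
  by rewrite du.
have wv : w != v by apply/eqP => wv; move: dw du; rewrite wv; clear; lia.
have [T' TT' sl] := slide_exists Tv uw wv.
have sumT' : total_dist T c = (total_dist T' c).+1.
  apply/eqP; rewrite eq_sym /total_dist (bigD1 v) //= [X in _ == X](bigD1 v) //=.
  rewrite (tdist_slid sl) 1?eq_sym // du dw -addSn eqn_add2l; apply/eqP.
  by apply: eq_bigr => y yv; rewrite (tdist_keep sl) // eq_sym.
have [|j [S [wT'S le_j S_star]]] := IH T'; first by rewrite -sumT'.
exists j.+1, S; split => //; last by rewrite sumT'.
by apply: (walk_trans (k := 1)) wT'S; exists [:: T']; rewrite /= TT'.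
Qed.

Lemma star_adj S c x y : (forall y, tdist S y c <= 1) ->
  adj (val S) x y = (x == c) (+) (y == c).
Proof.
move=> star.
have to_c z : z != c -> adj (val S) z c.
  by rewrite -(tdist_eq0 S) => z0; apply: tdist_eq1; apply/eqP; rewrite eqn_leq star lt0n.
have [->|xc] := eqVneq x c; have [->|yc] := eqVneq y c; rewrite /=.
- by apply/negP => /tree_adj_neq; rewrite eqxx.
- by rewrite adj_sym to_c.
- by rewrite to_c.
apply/negP => xy; have := tdist_adj_neq c xy.
by rewrite !tdist_adj ?to_c.
Qed.

Lemma star_uniq S S' c :
  (forall y, tdist S y c <= 1) -> (forall y, tdist S' y c <= 1) -> S = S'.
Proof. by move=> star star'; apply: tree_ext => x y; rewrite !(star_adj _ _ (c := c)). Qed.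

(** In the star centred at [c], the distances to another vertex [c'] sum to
    [1 + 2 * (n - 2)]; hence [walk_to_star] needs [n - 2] slides. *)
Lemma walk_star_star S S' c c' :
    (forall y, tdist S y c <= 1) -> (forall y, tdist S' y c' <= 1) ->
  exists2 j, walk (@slide n) j S S' & j <= n - 2.
Proof.
move=> star star'; have [ecc|ncc] := eqVneq c c'.
  exists 0 => //; exists [::]; split=> //=; apply: star_uniq star _.
  by rewrite ecc.
have [j [S'' [wlk le_j star'']]] := walk_to_star S c'.
rewrite (star_uniq star' star''); exists j => //.
(* [c'] and [c] fall short of the distance two by 2 and by 1 *)
have dist2 y : tdist S y c' + (y == c') * 2 + (y == c) <= 2.
  have [->|yc'] := eqVneq y c'; first by rewrite eq_sym (negPf ncc) tdistxx.
  have [->|yc] := eqVneq y c; first by rewrite tdistC; have := star c'; clear; lia.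
  have yc1 : adj (val S) y c by rewrite (star_adj _ _ star) eqxx (negPf yc).
  have := tdist_step c' yc1; have := star c'; rewrite [tdist S c' c]tdistC.
  by clear; lia.
have := leq_sum (index_enum 'I_n) (P := predT) (fun y _ => dist2 y).
rewrite !big_split -big_distrl /= !sum_eq1 sum_nat_const card_ord -/(total_dist S c').
by move: le_j; clear; lia.
Qed.

(** The walk from [y] to [b] stays in the branch and meets every distance from
    [b] up to that of [y]. *)
Lemma branch_levels T b c y i : adj (val T) b c -> y \in branch T b c ->
    i <= (tdist T y b).+1 ->
  i <= #|[set x in branch T b c | tdist T x b < i]|.
Proof.
move=> bc; have cb : adj (val T) c b by rewrite adj_sym.
move: {2}(tdist T y b) (erefl (tdist T y b)) => e; elim: e y i => [|e IH] y i dy yb.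
  rewrite dy; case: i => [//|[_|//]]; apply/card_gt0P; exists y.
  by rewrite inE yb dy.
have yb0 : y != b by rewrite -(tdist_eq0 T) dy.
have [p yp dp] := tdist_pred T yb0.
have pb : p \in branch T b c.
  move: yb; rewrite !inE => /eqP yb; have := tdist_step c yp; have := tdist_stepr p cb.
  by move: yb dp; clear; lia.
have dpe : tdist T p b = e by move: dp; rewrite dy => -[].
rewrite dy leq_eqVlt ltnS => /orP[/eqP->|le_ie]; last by apply: (IH p i dpe pb); rewrite dpe.
have le_e := IH p e.+1 dpe pb; rewrite dpe leqnn in le_e.
have y_new : y \notin [set x in branch T b c | tdist T x b < e.+1] by rewrite inE dy ltnn andbF.
have := cardsU1 y [set x in branch T b c | tdist T x b < e.+1]; rewrite y_new => eq_card.
apply: leq_trans (_ : #|y |: [set x in branch T b c | tdist T x b < e.+1]| <= _).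
  by rewrite eq_card ltnS le_e.
apply/subset_leq_card/subsetP => x; rewrite in_setU1 => /orP[/eqP->|].
  by rewrite inE yb dy ltnSn.
by rewrite !inE => /andP[-> /=]; apply: leq_trans.
Qed.

(** Crossing the edge [bc] changes every distance by one, and the side on which
    [x] lies decides in which direction. *)
Lemma branch_balance T b c x : adj (val T) b c ->
  tdist T x b + (x \in branch T b c) = tdist T x c + (x \in branch T c b).
Proof.
move=> bc; have cb : adj (val T) c b by rewrite adj_sym.
have := tdist_adj_neq x bc; rewrite ![tdist T _ x]tdistC !inE.
have := tdist_stepr x bc; have := tdist_stepr x cb; clear; lia.
Qed.

Lemma median_branch_le T b c : (forall c', total_dist T c <= total_dist T c') ->
  adj (val T) b c -> #|branch T b c| <= #|branch T c b|.
Proof.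
move=> c_min bc; have : \sum_x (tdist T x b + (x \in branch T b c)) =
    \sum_x (tdist T x c + (x \in branch T c b)).
  by apply: eq_bigr => x _; apply: branch_balance.
rewrite !big_split /= !sum_mem -/(total_dist T b) -/(total_dist T c).
by move=> e; rewrite -(leq_add2l (total_dist T b)) e leq_add2r.
Qed.

(** Few vertices can be far from a median [c].  The branch of [y] has a vertex
    at each distance [1, ..., j - 1] from [c].  Outside of that branch there is
    either a vertex at distance at least [j - 1], hence one at each distance
    [0, ..., j - 1], or no such vertex; then all of the outside is closer than
    [j], and by minimality the outside is at least as large as the branch, which
    has at least [j] vertices. *)
Lemma median_shallow T c y j : (forall c', total_dist T c <= total_dist T c') ->
  0 < j <= tdist T y c -> j.*2 <= #|[set x | tdist T x c < j]|.+1.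
Proof.
move=> c_min /andP[j_gt0 le_j].
have yc : c != y by apply: contraTneq le_j => ->; rewrite tdistxx -ltnNge.
have [b cb db] := tdist_pred T yc; have bc : adj (val T) b c by rewrite adj_sym.
have yb : y \in branch T b c by rewrite inE tdistC db tdistC.
have db' : tdist T y c = (tdist T y b).+1 by rewrite tdistC db tdistC.
set A := [set x | _].
pose Ab := [set x in branch T b c | tdist T x b < j.-1].
pose Ac := [set x in branch T c b | tdist T x c < j].
have Ab_le : j.-1 <= #|Ab|.
  by apply: branch_levels bc yb _; rewrite -db'; apply: leq_trans (leq_pred _) le_j.
have Ac_le : j <= #|Ac|.
  have [/existsP[y' /andP[y'c le_y']]|] :=
    boolP [exists y', (y' \in branch T c b) && (j <= (tdist T y' c).+1)].
    exact: branch_levels cb y'c le_y'.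
  rewrite negb_exists => /forallP shallow.
  have -> : Ac = branch T c b.
    apply/setP => x; rewrite !inE; apply: andb_idr => xc.
    by have := shallow x; rewrite !inE xc /= -ltnNge => /ltnW.
  apply: leq_trans (median_branch_le c_min bc).
  apply: leq_trans (branch_levels bc yb _) (_ : #|[set x in branch T b c | tdist T x b < j]| <= _).
    by rewrite -db'.
  by apply/subset_leq_card/subsetP => x; rewrite inE => /andP[].
have disj : [disjoint Ab & Ac].
  rewrite -setI_eq0; apply/eqP/setP => x; rewrite !inE; apply/negP.
  by move=> /andP[/andP[/eqP-> _] /andP[/eqP]]; clear; lia.
have sub : Ab :|: Ac \subset A.
  apply/subsetP => x; rewrite !inE => /orP[/andP[/eqP-> lt_x]|/andP[]//].
  by move: lt_x; clear; lia.
have := subset_leq_card sub; rewrite (eqP (_ : #|Ab :|: Ac| == #|Ab| + #|Ac|)).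
  by move: Ab_le Ac_le j_gt0; clear; lia.
by rewrite (leq_card_setU Ab Ac).
Qed.

(** If [h] is the largest distance from a median, the sum of the distances is
    the sum over [i < h] of the number of vertices farther than [i], which is at
    most [n - (2 * i + 1)] by [median_shallow]; the total is at most
    [h * (n - h)]. *)
Lemma median T : 0 < n -> exists c, total_dist T c <= n ^ 2 %/ 4.
Proof.
move=> n_gt0; pose c := [arg min_(c < Ordinal n_gt0) total_dist T c].
have c_min c' : total_dist T c <= total_dist T c' by rewrite /c; case: arg_minnP => // i _; apply.
exists c; pose y := [arg max_(y > c) tdist T y c].
have y_max x : tdist T x c <= tdist T y c by rewrite /y; case: arg_maxnP => // i _; apply.
have levels h : h <= tdist T y c ->
    \sum_(i < h) #|[set x | i < tdist T x c]| + h * h <= h * n.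
  elim: h => [|h IH] lt_h; first by rewrite big_ord0.
  pose shallow := #|[set x | tdist T x c < h.+1]|; pose deep := #|[set x | h < tdist T x c]|.
  have split_n : shallow + deep = n.
    rewrite -[RHS]card_ord -(cardsC [set x | tdist T x c < h.+1]); congr (_ + _).
    by apply: eq_card => x; rewrite !inE -leqNgt.
  have shallow_ge : h.+1.*2 <= shallow.+1  := median_shallow (j := h.+1) c_min lt_h.
  rewrite big_ord_recr /= -/deep; have := IH (ltnW lt_h).
  by move: (\sum_(i < h) _) shallow deep split_n shallow_ge => s t d; clear; nia.
have -> : total_dist T c = \sum_(i < tdist T y c) #|[set x | i < tdist T x c]|.
  under [RHS]eq_bigr do rewrite -sum_mem.
  rewrite exchange_big /=; apply: eq_bigr => x _.
  under eq_bigr do rewrite inE.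
  by rewrite sum_lt // y_max.
have := levels _ (leqnn _); set s := \sum_(_ < _) _; move: (tdist T y c) s => h s le_s.
rewrite leq_divRL //.
have [le_hn|lt_nh] := leqP h n; last by move: le_s lt_nh; clear; nia.
have [agm _] := nat_AGM2 h (n - h); rewrite subnKC // in agm.
have : s <= h * (n - h) by rewrite mulnBr leq_subRL 1?addnC ?leq_mul.
by move: agm; clear; lia.
Qed.

Lemma walk_upper T T' : 3 <= n ->
  exists2 k, walk (@slide n) k T T' & k + n <= 2 * (n ^ 2 %/ 4).
Proof.
move=> n_gt2; have n_gt0 : 0 < n by apply: leq_trans n_gt2.
have [c c_le] := median T n_gt0; have [c' c'_le] := median T' n_gt0.
have [j [S [wS le_j star]]] := walk_to_star T c.
have [j' [S' [wS' le_j' star']]] := walk_to_star T' c'.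
have [i wSS le_i] := walk_star_star star star'.
exists (j + (i + j')).
  by apply: walk_trans wS (walk_trans wSS _); apply: walk_rev wS'; apply: slide_sym.
by move: le_i le_j le_j' c_le c'_le n_gt2; clear; lia.
Qed.

End UpperBound.

(** * Counting how often each vertex is slid *)

Section Runs.
Variable n : nat.
Implicit Types (T S : tree n) (u v w x y z b c : 'I_n) (vs : seq 'I_n).

Definition moves vs x : nat := count_mem x vs.

Arguments moves : simpl never.

Lemma moves_cons v vs x : moves (v :: vs) x = (x == v) + moves vs x.
Proof. by rewrite /moves /= eq_sym. Qed.

Fixpoint run vs T T' : Prop :=
  if vs is v :: vs' then exists2 S, slides v T S & run vs' S T' else T = T'.

Lemma run_cat vs1 vs2 T T' :
  run (vs1 ++ vs2) T T' <-> exists2 S, run vs1 T S & run vs2 S T'.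
Proof.
elim: vs1 T => [|v vs IH] T /=; first by split=> [r|[S ->]] //; exists T.
split=> [[R TR /IH[S RS ST']]|[S [R TR RS] ST']]; first by exists S => //; exists R.
by exists R => //; apply/IH; exists S.
Qed.

Lemma run_rev vs T T' : run vs T T' -> run (rev vs) T' T.
Proof.
elim: vs T => [|v vs IH] T /= => [-> //|[S TS /IH ST']].
by rewrite rev_cons -cats1; apply/run_cat; exists S => //=; exists T => //; apply: slides_sym.
Qed.

Lemma walk_run k T T' : walk (@slide n) k T T' -> exists2 vs, run vs T T' & size vs = k.
Proof.
case=> p; elim: p k T => [|S p IH] [|k] T [] //=; first by move=> _ -> _; exists [::].
move=> /andP[/slide_slides[v TS] pS] lS [sS].
by have [vs run_vs <-] := IH k S (And3 pS lS sS); exists (v :: vs) => //; exists S.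
Qed.

Lemma run_tdist_le vs T T' x c : c \notin vs -> run vs T T' ->
  tdist T' x c <= tdist T x c + moves vs x.
Proof.
elim: vs T => [|v vs IH] T /= => [_ -> |]; first by rewrite addn0.
rewrite moves_cons.
rewrite inE negb_or => /andP[cv cvs] [S TS /IH-/(_ cvs) le1].
have := tdist_slide_le x TS cv.
by case: (x == v); lia.
Qed.

Lemma moves_rev vs x : moves (rev vs) x = moves vs x.
Proof. exact: count_rev. Qed.

(** Following [y] through the walk: while it stays in the branch, each slide of
    [y] changes its distance to [c] by at most one.  It can leave only by sliding
    from [b] to [c], where it becomes adjacent to [c], or it is [b] itself.  From
    then on the slides of [y] account for its final distance. *)
Lemma run_branch vs T T' b c y : run vs T T' -> c \notin vs ->
    adj (val T) c b -> b \in vs -> y \in branch T b c ->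
  (tdist T y c).-1 + (tdist T' y c).-1 <= moves vs y.
Proof.
elim: vs T y => [|v vs IH] T y //= [S TS run_vs].
rewrite moves_cons.
rewrite inE negb_or => /andP[cv cvs] cb bvs yb.
have le_y := tdist_slide_le y TS cv; have lip := run_tdist_le y cvs run_vs.
have [u [w sl]] := TS; have [uv wv uw'] := slide_from_neq sl; have [Tv Sv uw keep] := sl.
have [bv|bv] := eqVneq b v.
  have cu : c = u by apply/eqP; rewrite -Tv adj_sym -bv.
  have yv : y = v.
    apply: contraTeq yb => yv; rewrite inE tdistC [tdist T y b]tdistC bv cu.
    by rewrite (tdist_leaf Tv) //; clear; lia.
  by move: le_y lip; rewrite yv eqxx cu (tdist_leaf Tv) // tdistxx; clear; lia.
have {}bvs : b \in vs by move: bvs; rewrite inE (negPf bv).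
have cbS : adj (val S) c b by rewrite keep.
have bc : adj (val T) b c by rewrite adj_sym.
have [yv|yv] := eqVneq y v; last first.
  have yS : y \in branch S b c by move: yb; rewrite !inE !(tdist_keep sl).
  by have := IH S y run_vs cvs cbS bvs yS; rewrite (tdist_keep sl) //; lia.
have ub : u \in branch T b c.
  by move: yb; rewrite yv !inE !(tdist_leaf Tv) // eqSS.
have [wb|wb] := boolP (w \in branch T b c).
  have vS : v \in branch S b c by move: wb; rewrite !inE !(tdist_slid sl) // eqSS.
  have := IH S v run_vs cvs cbS bvs vS; have := tdist_step c uw.
  by rewrite yv (tdist_slid sl) // (tdist_leaf Tv) //; clear; lia.
have [eub ewc] := branch_exit bc uw ub wb.
move: lip; rewrite yv (tdist_slid sl) // (tdist_leaf Tv) // ewc tdistxx eub (tdist_adj bc); clear; lia.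
Qed.

Lemma run_unmoved vs T T' c y : run vs T T' -> c \notin vs ->
    (forall b, adj (val T) c b -> b \in vs) -> y != c ->
  (tdist T y c).-1 + (tdist T' y c).-1 <= moves vs y.
Proof.
move=> r cvs nbrs yc; have [b cb db] : exists2 b, adj (val T) c b & tdist T c y = (tdist T b y).+1.
  by apply: tdist_pred; rewrite eq_sym.
apply: (run_branch r cvs cb); first exact: nbrs.
by rewrite inE tdistC db tdistC.
Qed.

(** [c] is the last vertex to be slid for the first time.  Just before its first
    slide it is a leaf whose only neighbour is [z]; every other vertex is at
    distance at least two from [c], which makes up for the loss of one in
    [run_unmoved]. *)
Lemma run_all_moved vs T T' : 0 < n -> run vs T T' -> (forall y, y \in vs) ->
  exists c z, forall y, tdist T y c <= moves vs y + (y == z).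
Proof.
move=> n_gt0 r all_vs.
pose c := [arg max_(c > Ordinal n_gt0) index c vs].
have c_max y : index y vs <= index c vs by rewrite /c; case: arg_maxnP => // i _; apply.
have := r; rewrite -{1}(cat_take_drop (index c vs) vs) => /run_cat[S].
rewrite (drop_nth c) ?index_mem // nth_index // => r1 [R [z [w [Sc _ _ _]]] _].
exists c, z => y; have [->|yc] := eqVneq y c; first by rewrite tdistxx.
have cvs1 : c \notin take (index c vs) vs by rewrite in_take // ltnn.
have vs1 x : x != c -> x \in take (index c vs) vs.
  move=> xc; rewrite in_take // ltn_neqAle c_max andbT.
  by apply: contraNneq xc => e; rewrite -(nth_index c (all_vs x)) e nth_index.
have nbrs b : adj (val T) c b -> b \in take (index c vs) vs.
  by move=> cb; rewrite vs1 // eq_sym (tree_adj_neq cb).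
have le1 := run_unmoved r1 cvs1 nbrs yc.
have le2 : moves (take (index c vs) vs) y <= moves vs y.
  by rewrite -[X in _ <= moves X _](cat_take_drop (index c vs)) /moves count_cat leq_addr.
have pos_y : 0 < tdist S y c by rewrite lt0n tdist_eq0.
have [_|yz] := eqVneq y z; first by move: le1 le2 pos_y; clear; lia.
have far_y : tdist S y c != 1.
  by apply: contraNneq yz; rewrite tdistC => /tdist_eq1; rewrite Sc.
by move: le1 le2 pos_y far_y; clear; lia.
Qed.

End Runs.

Definition gap (i j : nat) : nat := (i - j) + (j - i).

(** * Hamiltonian paths *)

Section PathTree.
Variables (n : nat) (s : 'I_n -> 'I_n).
Hypothesis s_inj : injective s.

(** The path in which [x] is the vertex at position [s x]. *)
Definition path_edges : {set {set 'I_n}} :=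
  [set [set p.1; p.2] | p in [set p : 'I_n * 'I_n | (s p.1).+1 == s p.2]].

Lemma path_adj x y : adj path_edges x y = (gap (s x) (s y) == 1).
Proof.
rewrite /adj /=; apply/imsetP/idP => [[[a b]]|].
  rewrite inE /= => ab /eqP; rewrite set2_eq.
  by case/orP=> /andP[/eqP-> /eqP->]; move: ab; rewrite /gap; clear; lia.
rewrite /gap => g1; have [lt_xy|le_yx] := ltnP (s x) (s y).
  by exists (x, y) => //; rewrite inE /=; move: g1 lt_xy; clear; lia.
by exists (y, x); rewrite /= 1?setUC // inE /=; move: g1 le_yx; clear; lia.
Qed.

Lemma path_simple : simple path_edges.
Proof.
apply/forall_inP => a /imsetP[[x y]]; rewrite inE /= => xy ->.
rewrite cards2; have [exy|//] := eqVneq x y.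
by move: xy; rewrite exy; clear; lia.
Qed.

Lemma path_connected : connected path_edges.
Proof.
have adj_s : symmetric (adj path_edges) := @adj_sym n path_edges.
have [s' _ sK] := injF_bij s_inj.
have up k x y : s y = s x + k :> nat -> connect (adj path_edges) x y.
  elim: k y => [|k IH] y eq_y.
    by have -> : y = x by apply/s_inj/val_inj; rewrite /= eq_y addn0.
  have lt_k : s x + k < n by have := ltn_ord (s y); move: eq_y; clear; lia.
  have sz : s (s' (Ordinal lt_k)) = s x + k :> nat by rewrite sK.
  apply: connect_trans (IH _ sz) (connect1 _).
  by rewrite path_adj /gap sz eq_y; clear; lia.
apply/forallP => x; apply/forallP => y.
have [le_xy|lt_yx] := leqP (s x) (s y); first by apply: (up (s y - s x)); rewrite subnKC.
by rewrite (sym_connect_sym adj_s); apply: (up (s x - s y)); rewrite subnKC // ltnW.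
Qed.

(** The vertex of a cycle with the largest position would have two neighbours at
    the position before it. *)
Lemma path_acyclic : acyclic path_edges.
Proof.
apply/acyclicP => p p_gt2 cyc.
have [x0 x0p] : exists x0, x0 \in p by case: p p_gt2 {cyc} => // x0 p; exists x0; rewrite mem_head.
pose x := [arg max_(x > x0 in p) (s x : nat)].
have [xp x_max] : x \in p /\ forall y, y \in p -> s y <= s x by rewrite /x; case: arg_maxnP.
have [y [z [yz yp zp xy xz]]] := cycle_two_neighbours p_gt2 cyc xp.
case/eqP: yz; apply/s_inj/val_inj => /=; move: xy xz (x_max y yp) (x_max z zp).
by rewrite !path_adj /gap; clear; lia.
Qed.

Lemma path_is_tree : is_tree path_edges.
Proof. by rewrite /is_tree path_simple path_connected path_acyclic. Qed.

Definition path_tree : tree n := Sub path_edges path_is_tree.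

Lemma tdist_path x y : tdist path_tree x y = gap (s x) (s y).
Proof.
rewrite [LHS](@dist_unique _ _ (@tree_connect _ path_tree) (fun x => gap (s x) (s y))) //.
- by rewrite /gap; clear; lia.
- by move=> a b; rewrite path_adj /gap; clear; lia.
move=> a ay; have [s' _ sK] := injF_bij s_inj.
have nay : s a != s y :> nat by apply: contra ay => /eqP/val_inj/s_inj->.
have [lt_ay|le_ya] := ltnP (s a) (s y).
  have lt_b : (s a).+1 < n by have := ltn_ord (s y); move: lt_ay; clear; lia.
  have sb : s (s' (Ordinal lt_b)) = (s a).+1 :> nat by rewrite sK.
  by exists (s' (Ordinal lt_b)); rewrite ?path_adj sb /gap; move: lt_ay; clear; lia.
have lt_b : (s a).-1 < n by have := ltn_ord (s a); clear; lia.
have sb : s (s' (Ordinal lt_b)) = (s a).-1 :> nat by rewrite sK.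
by exists (s' (Ordinal lt_b)); rewrite ?path_adj sb /gap; move: le_ya nay; clear; lia.
Qed.

End PathTree.

(** * Distances from a position to the outer positions *)

Section OuterSum.
Variable n : nat.

Definition outer (q : nat) (x : 'I_n) : bool := (x < q) || (n <= x + q).

(** One position if [n] is odd, two if [n] is even. *)
Definition middle (c : 'I_n) : bool := (n <= c.*2.+2) && (c.*2 <= n).

Lemma outer_sumS q (c : 'I_n) : q.+1.*2 <= n ->
  \sum_(x | outer q.+1 x) gap x c =
    gap q c + gap (n - q.+1) c + \sum_(x | outer q x) gap x c.
Proof.
move=> qn.
have lo_lt : q < n by lia.
have hi_lt : n - q.+1 < n by lia.
pose lo := Ordinal lo_lt; pose hi := Ordinal hi_lt.
have hi_neq : hi != lo by rewrite -val_eqE /=; lia.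
rewrite (bigD1 lo) /=; last by rewrite /outer /=; lia.
rewrite (bigD1 hi) /=; last by rewrite hi_neq /outer /=; lia.
rewrite addnA; congr (_ + _); apply: eq_bigl => x.
by rewrite /outer -!val_eqE /=; have := ltn_ord x; lia.
Qed.

(** The two positions [i] and [n - 1 - i] are together at distance at least
    [n - 1 - 2 * i] from any [c], by the triangle inequality. *)
Lemma outer_sum q (c : 'I_n) : q.*2 <= n ->
  q * (n - q) <= \sum_(x | outer q x) gap x c.
Proof.
elim: q => [|q IH] qn; first by rewrite mul0n.
have /IH : q.*2 <= n by lia.
by rewrite outer_sumS // /gap; nia.
Qed.

(** All positions but the middle one, if [n] is odd, are outer; the gain away
    from the middle comes from the innermost position or pair of positions. *)
Lemma total_sum (c : 'I_n) :
  n./2 * (n - n./2) + (~~ middle c) * (2 - odd n) <= \sum_(x : 'I_n) gap x c.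
Proof.
have := ltn_ord c => c_lt.
have [odd_n|even_n] := boolP (odd n).
  have mid_lt : n./2 < n by lia.
  rewrite (bigD1 (Ordinal mid_lt)) //= (eq_bigl (outer n./2)).
    have /outer_sum-/(_ c) : n./2.*2 <= n by lia.
    by rewrite /gap; case: (boolP (middle c)); rewrite /middle /=; lia.
  by move=> x; rewrite /outer -val_eqE /=; have := ltn_ord x; lia.
have [k defn] : exists k, n = k.+1.*2 by exists n./2.-1; lia.
rewrite (eq_bigl (outer k.+1)); last by move=> x; rewrite /outer; have := ltn_ord x; lia.
have half_n : n./2 = k.+1 by lia.
rewrite outer_sumS -?defn // half_n.
have /outer_sum-/(_ c) : k.*2 <= n by lia.
have -> : k.+1 * (n - k.+1) = k * (n - k) + 1.
  have [-> ->] : n - k = k.+2 /\ n - k.+1 = k.+1 by lia.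
  by nia.
by rewrite /gap; case: (boolP (middle c)); rewrite /middle /=; lia.
Qed.

Variable s : 'I_n -> 'I_n.
Hypothesis s_inj : injective s.

Lemma outer_sum_inj q (c : 'I_n) : q.*2 <= n ->
  q * (n - q) <= \sum_(x | outer q (s x)) gap (s x) (s c).
Proof.
move=> qn.
by rewrite -(reindex_inj (F := fun x : 'I_n => gap x (s c)) (P := outer q) s_inj) outer_sum.
Qed.

Lemma total_sum_inj (c : 'I_n) :
  n./2 * (n - n./2) + (~~ middle (s c)) * (2 - odd n) <= \sum_(x : 'I_n) gap (s x) (s c).
Proof.
by rewrite -(reindex_inj (F := fun x : 'I_n => gap x (s c)) (P := predT) s_inj) total_sum.
Qed.

End OuterSum.

(** * A second path with its outer vertices in the middle of the first *)

(** A permutation of the positions [0, ..., 2m - 1] carrying the outermost pair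
    [0], [2m - 1] to the middle and the middle pair to the ends: the pair
    [t], [2m - 1 - t] goes to [m - 1 - t], [m + t].  Switching the sides for odd
    [t] makes consecutive positions land on opposite sides of the middle, so
    that no edge of the path is kept. *)
Definition weave (m x : nat) : nat :=
  let t := minn x (m.*2.-1 - x) in
  if (x < m) (+) odd t then m.-1 - t else m + t.

Variant weave_spec (m x : nat) : nat -> Prop :=
  | WeaveLeft t of t < m & (x = t /\ ~~ odd t \/ x = m.*2.-1 - t /\ odd t) :
    weave_spec m x (m.-1 - t)
  | WeaveRight t of t < m & (x = t /\ odd t \/ x = m.*2.-1 - t /\ ~~ odd t) :
    weave_spec m x (m + t).

Lemma weaveP m x : x < m.*2 -> weave_spec m x (weave m x).
Proof.
rewrite /weave => x_lt; set t := minn _ _.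
by case: ifP => c; constructor; rewrite /t in c *; lia.
Qed.

Lemma weave_lt m x : x < m.*2 -> weave m x < m.*2.
Proof. by case/weaveP; lia. Qed.

Lemma weave_inj m x y : x < m.*2 -> y < m.*2 -> weave m x = weave m y -> x = y.
Proof. by case/weaveP=> t t_lt xt /weaveP[] t' t'_lt yt'; lia. Qed.

Lemma weave_gap m x : 1 < m -> x.+1 < m.*2 -> 1 < gap (weave m x) (weave m x.+1).
Proof.
move=> m_gt1 x_lt; have /weaveP[t t_lt xt|t t_lt xt] : x < m.*2 by apply: ltnW.
  by have [t' t'_lt yt'|t' t'_lt yt'] := weaveP x_lt; rewrite /gap; lia.
by have [t' t'_lt yt'|t' t'_lt yt'] := weaveP x_lt; rewrite /gap; lia.
Qed.

Lemma weave_last m : 0 < m -> weave m m.*2.-1 = m.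
Proof. by move=> m_gt0; have /weaveP[] : m.*2.-1 < m.*2; lia. Qed.

(** For odd [n] the last vertex [n - 1] is inserted into the woven path of the
    others, between [n - 3] and [0]: near the middle but not next to [n - 2],
    its neighbour in the first path. *)
Definition cross_pos (n x : nat) : nat :=
  let m := n./2 in
  if x == m.*2 then m.-1 else if odd n then bump m.-1 (weave m x) else weave m x.

Lemma gap_bump h i j : gap i j <= gap (bump h i) (bump h j).
Proof. by rewrite /gap /bump; lia. Qed.

Lemma cross_pos_lt n x : x < n -> cross_pos n x < n.
Proof.
rewrite /cross_pos => x_lt; case: eqP => xm; first lia.
have /weave_lt : x < n./2.*2 by lia.
by case: ifP; rewrite /bump; lia.
Qed.

Lemma cross_pos_inj n x y : x < n -> y < n -> cross_pos n x = cross_pos n y -> x = y.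
Proof.
rewrite /cross_pos => x_lt y_lt; case: eqP => xm; case: eqP => ym; first lia.
- by case: ifP => odd_n; rewrite /bump; lia.
- by case: ifP => odd_n; rewrite /bump; lia.
by case: ifP => _; [move/(can_inj (bumpK _))|]; apply: weave_inj; lia.
Qed.

Lemma cross_pos_gap n x : 3 < n -> x.+1 < n ->
  gap (cross_pos n x) (cross_pos n x.+1) != 1.
Proof.
move=> n_gt3 x_lt; rewrite neq_ltn; apply/orP; right; rewrite /cross_pos.
have m_gt1 : 1 < n./2 by lia.
have -> : (x == n./2.*2) = false by lia.
case: eqP => xm; last first.
  have g := @weave_gap n./2 x m_gt1 ltac:(lia).
  by case: ifP => _ //; apply: leq_trans g (gap_bump _ _ _).
have -> : odd n by lia.
have -> : x = n./2.*2.-1 by lia.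
by rewrite weave_last /gap /bump; lia.
Qed.

Lemma cross_pos_middle n x : 3 < n -> x < n -> (n <= x.*2.+2) && (x.*2 <= n) ->
  (n <= (cross_pos n x).*2.+2) && ((cross_pos n x).*2 <= n) -> false.
Proof.
move=> n_gt3 x_lt; rewrite /cross_pos; case: eqP => xm; first lia.
have /weaveP[t t_lt xt|t t_lt xt] : x < n./2.*2 by lia.
  by case: ifP; rewrite /bump; lia.
by case: ifP; rewrite /bump; lia.
Qed.

Lemma cross_pos_outer n x q1 q2 : 3 < n -> x < n -> q1 = n./2./2 -> q2 = n./2 - q1 ->
  (x < q1) || (n <= x + q1) ->
  (cross_pos n x < q2) || (n <= cross_pos n x + q2) -> false.
Proof.
move=> n_gt3 x_lt q1E q2E; rewrite /cross_pos; case: eqP => xm; first lia.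
have /weaveP[t t_lt xt|t t_lt xt] : x < n./2.*2 by lia.
  by case: ifP; rewrite /bump; lia.
by case: ifP; rewrite /bump; lia.
Qed.

(** * The lower bound *)

Lemma gapC i j : gap i j = gap j i.
Proof. exact: addnC. Qed.

Definition lower_bound (n : nat) : nat :=
  if odd n then (3 * n ^ 2 - 6 * n) %/ 8 else (3 * n ^ 2 - 4 * n) %/ 8.

Lemma lower_bound_moved n k (q1 := n./2./2) (q2 := n./2 - q1) : 3 < n ->
  q1 * (n - q1) + q2 * (n - q2) <= k + 2 -> lower_bound n <= k.
Proof.
rewrite /lower_bound => n_gt3.
(* [n = 4 * h + 2 * b + r], with the parities [b] of [n./2] and [r] of [n] *)
have [h [e1 e2]] : exists h, q1 = h /\ n = (h + odd n./2 + h) * 2 + odd n.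
  by exists q1; split=> //; rewrite /q1; lia.
have -> : q2 = h + odd n./2 by rewrite /q2 e1; lia.
rewrite e1; move: (odd n./2) e2 n_gt3 => b; case: (odd n) => e2; rewrite {}e2.
  have -> : (h + b + h) * 2 + true - h = h + b + b + h + 1 + h by lia.
  have -> : (h + b + h) * 2 + true - (h + b) = h + b + h + 1 + h by lia.
  by case: b; nia.
have -> : (h + b + h) * 2 + false - h = h + b + b + h + h by lia.
have -> : (h + b + h) * 2 + false - (h + b) = h + b + h + h by lia.
by case: b; nia.
Qed.

Lemma lower_bound_unmoved n k : 3 < n ->
  2 * (n./2 * (n - n./2)) + (2 - odd n) <= k + 2 * n.-1 -> lower_bound n <= k.
Proof.
rewrite /lower_bound => n_gt3.
have [m [e1 e2]] : exists m, n./2 = m /\ n = m * 2 + odd n by exists n./2; lia.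
rewrite e1; case: (odd n) e2 n_gt3 => e2; rewrite {}e2.
  have -> : m * 2 + true - m = m + 1 by lia.
  by nia.
have -> : m * 2 + false - m = m by lia.
(* [(m - 3) ^ 2 >= 0] *)
have sq : 6 * m <= m * m + 9.
  by have [m_lt3|/subnK <-] := ltnP m 3; [lia | nia].
by lia.
Qed.

Section LowerBound.
Variable n : nat.
Implicit Types (x y z c : 'I_n) (vs : seq 'I_n).

Definition cross x : 'I_n := Ordinal (cross_pos_lt (ltn_ord x)).

Lemma cross_inj : injective cross.
Proof. by move=> x y /(congr1 val) /= e; apply/val_inj/(cross_pos_inj _ _ e). Qed.

Definition straight_path : tree n := path_tree (@inj_id 'I_n).
Definition crossing_path : tree n := path_tree cross_inj.

Lemma paths_edge_disjoint x y : 3 < n ->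
  adj (val straight_path) x y -> ~~ adj (val crossing_path) x y.
Proof.
move=> n_gt3; rewrite /= !path_adj /=.
wlog lt_xy : x y / x < y => [IH|].
  have [/IH//|lt_yx|/val_inj->] := ltngtP x y; last by rewrite /gap; clear; lia.
  by move: (IH y x lt_yx); rewrite !(gapC y) !(gapC (cross_pos n y)).
move=> g1; have eq_y : y = x.+1 :> nat by move: g1 lt_xy; rewrite /gap; clear; lia.
by rewrite eq_y; apply: cross_pos_gap; rewrite -?eq_y.
Qed.

Lemma sum_moves vs : \sum_y moves vs y = size vs.
Proof.
elim: vs => [|v vs IH]; first by rewrite big1.
under eq_bigr do rewrite moves_cons.
by rewrite big_split /= IH (bigD1 v) //= eqxx big1 // => y /negPf->.
Qed.

Lemma sum_center_le (f g h : 'I_n -> nat) c :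
    (forall y, f y + g y + (y == c) * 2 <= h y + 2) ->
  \sum_y f y + \sum_y g y + 2 <= \sum_y h y + n * 2.
Proof.
move=> le_fgh; have := leq_sum (index_enum 'I_n) (P := predT) (fun y _ => le_fgh y).
by rewrite !big_split -big_distrl /= sum_eq1 sum_nat_const card_ord.
Qed.

Lemma sum_two_le (f g h : 'I_n -> nat) z z' :
    (forall y, f y + g y <= h y + ((y == z) + (y == z'))) ->
  \sum_y f y + \sum_y g y <= \sum_y h y + 2.
Proof.
move=> le_fgh; have := leq_sum (index_enum 'I_n) (P := predT) (fun y _ => le_fgh y).
by rewrite !big_split /= !sum_eq1.
Qed.

(** The neighbours of [c] in the first path have to be slid, because none of them
    is a neighbour of [c] in the second one.  The term [2 - odd n] is the gain of
    [total_sum], available since [c] is in the middle of at most one path. *)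
Lemma run_lower_unmoved vs c : 3 < n -> run vs straight_path crossing_path ->
  c \notin vs ->
  2 * (n./2 * (n - n./2)) + (2 - odd n) <= size vs + 2 * n.-1.
Proof.
move=> n_gt3 r cvs.
have nbrs b : adj (val straight_path) c b -> b \in vs.
  move=> cb; apply: contraT => bvs; have bc : b != c by rewrite eq_sym (tree_adj_neq cb).
  have := run_tdist_le b cvs r; rewrite /moves (count_memPn bvs) addn0.
  rewrite tdistC [X in _ <= X]tdistC (tdist_adj cb) => d1.
  have /tdist_eq1 : tdist crossing_path c b = 1.
    by apply/eqP; rewrite eqn_leq d1 lt0n tdist_eq0 eq_sym.
  by rewrite (negPf (paths_edge_disjoint n_gt3 cb)).
(* at [c] both distances vanish, which leaves room for an additional 2 *)
have le_y y : gap y c + gap (cross y) (cross c) + (y == c) * 2 <= moves vs y + 2.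
  have [->|yc] := eqVneq y c; first by rewrite /gap; clear; lia.
  have := run_unmoved r cvs nbrs yc; rewrite !tdist_path.
  by clear; lia.
have := sum_center_le le_y; rewrite sum_moves.
have := total_sum c; have := total_sum_inj cross_inj c.
have := ltn_ord c; have := @cross_pos_middle n c n_gt3 (ltn_ord c).
have -> : cross_pos n c = cross c by [].
rewrite -/(middle c) -/(middle (cross c)).
case: (middle c) => mid; last first.
  by move: n_gt3; clear; case: (middle _); case: (odd n); rewrite /=; lia.
have -> : middle (cross c) = false by apply/negP => /(mid isT).
by move: n_gt3; clear; case: (odd n); rewrite /=; lia.
Qed.

(** The [2 * q1] outer vertices of the first path and the [2 * q2] outer vertices
    of the second one are disjoint.  The first are counted by their distance to
    the centre obtained from the walk, the others by their distance to the
    centre obtained from the reversed walk; each walk loses at most one. *)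
Lemma run_lower_moved vs (q1 := n./2./2) (q2 := n./2 - q1) : 3 < n ->
  run vs straight_path crossing_path -> (forall y, y \in vs) ->
  q1 * (n - q1) + q2 * (n - q2) <= size vs + 2.
Proof.
move=> n_gt3 r all_vs; have n_gt0 : 0 < n by apply: leq_trans n_gt3.
have [c [z le1]] := run_all_moved n_gt0 r all_vs.
have [c' [z' le2]] : exists c z, forall y,
    tdist crossing_path y c <= moves vs y + (y == z).
  have all_rev y : y \in rev vs by rewrite mem_rev.
  have [c' [z' le2]] := run_all_moved n_gt0 (run_rev r) all_rev.
  by exists c', z' => y; rewrite -moves_rev.
have le_y y : (if outer q1 y then gap y c else 0) +
    (if outer q2 (cross y) then gap (cross y) (cross c') else 0)
    <= moves vs y + ((y == z) + (y == z')).
  have := le1 y; have := le2 y; rewrite !tdist_path /=.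
  have := @cross_pos_outer n y q1 q2 n_gt3 (ltn_ord y) (erefl _) (erefl _).
  rewrite -/(outer q1 y) -[_ || _]/(outer q2 (cross y)).
  case: (outer q1 y); case: (outer q2 _) => disj; first by have := disj isT isT.
  - by clear; lia.
  - by clear; lia.
  by clear; lia.
have := sum_two_le le_y; rewrite sum_moves -!big_mkcond /=; apply: leq_trans.
by apply: leq_add; [apply: outer_sum | apply: (outer_sum_inj cross_inj)]; rewrite /q2 /q1; clear; lia.
Qed.

Lemma lower_bound_run vs : 3 <= n -> run vs straight_path crossing_path ->
  lower_bound n <= size vs.
Proof.
rewrite leq_eqVlt => /orP[/eqP n3|n_gt3] r.
  have -> : lower_bound n = 1 by rewrite /lower_bound -n3.
  case: vs r => //= eqT.
  have lt1 : 1 < n by rewrite -n3.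
  have lt2 : 2 < n by rewrite -n3.
  have := tdist_path (@inj_id 'I_n) (Ordinal lt1) (Ordinal lt2).
  by rewrite -/straight_path eqT tdist_path /= -n3.
have [all_vs|] := boolP [forall c, c \in vs].
  exact: lower_bound_moved (run_lower_moved n_gt3 r (forallP all_vs)).
rewrite negb_forall => /existsP[c cvs].
exact: lower_bound_unmoved (run_lower_unmoved n_gt3 r cvs).
Qed.

End LowerBound.

(** * The diameter *)

Theorem theorem3p3 (n : nat) (hn : 3 <= n) :
  exists D : nat,
    is_diameter (@slide n) D /\
    (~~ odd n ->
       (3 * n ^ 2 - 4 * n) %/ 8 <= D /\ D <= n ^ 2 %/ 2 - n) /\
    (odd n ->
       (3 * n ^ 2 - 6 * n) %/ 8 <= D /\ D <= (n ^ 2 - 1) %/ 2 - n).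
Proof.
pose d (p : tree n * tree n) := dist (@slide n) p.1 p.2.
pose P1 := straight_path n; pose P2 := crossing_path n.
have d_is_dist T T' : is_dist (@slide n) T T' (d (T, T')).
  apply: dist_is_dist; have [k [p [pth <- _]] _] := walk_upper T T' hn.
  by apply/connectP; exists p.
have d_upper p : d p + n <= 2 * (n ^ 2 %/ 4).
  have [k wk le_k] := walk_upper p.1 p.2 hn.
  by apply: leq_trans le_k; rewrite leq_add2r; apply: dist_min.
have d_lower : lower_bound n <= d (P1, P2).
  have [/walk_run[vs run_vs <-] _] := d_is_dist P1 P2.
  exact: lower_bound_run hn run_vs.
have nonempty : 0 < #|{: tree n * tree n}| by apply/card_gt0P; exists (P1, P2).
have [[T T'] maxE] := eq_bigmax d nonempty.
have D_upper := d_upper (T, T').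
have d_max p : d p <= d (T, T') by rewrite -maxE; apply: leq_bigmax.
have D_lower := leq_trans d_lower (d_max _).
exists (d (T, T')); split.
  split; last by exists T, T'; apply: d_is_dist.
  by move=> S S'; exists (d (S, S')); [apply: d_is_dist | apply: d_max].
rewrite /lower_bound in D_lower; move: (d (T, T')) D_upper D_lower => D.
have n_eq : n = n./2 * 2 + odd n by rewrite muln2 addnC odd_double_half.
move: (n./2) n_eq => m; case: (odd n) => -> {hn}; split=> // _; split=> //; nia.
Qed.
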